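(* Let $\mathcal{L}\subseteq\mathrm{Scat}$ be nonempty, downward $\preceq$-closed and ccs. Then ${\trianglelefteq^{\mathcal{L}}_{\mathrm{LO}_{\mathbb{N}}}}\sim_B{\trianglelefteq^{\mathcal{L}}_{\mathrm{LO}}}$.
   Context: Linear orders are reflexive and nonempty. $L\preceq L'$ means there is an embedding $f:L\to L'$, i.e. $x\le_L y\iff f(x)\le_{L'}f(y)$. $\mathrm{LO}\subseteq 2^{\mathbb{N}\times\mathbb{N}}$ is the Polish space of codes for linear orders with domain $\mathbb{N}$; $\mathrm{Fin}$ is the set of codes for nonempty linear orders on finite subsets of $\mathbb{N}$; $\mathrm{Lin}=\mathrm{Fin}\cup\mathrm{LO}$; $\mathrm{Scat}\subseteq\mathrm{Lin}$ is the set of scattered ones (those $L$ with $\mathbb{Q}\not\preceq L$). A class $\mathcal{L}\subseteq\mathrm{Lin}$ is downward $\preceq$-closed if $K\in\mathrm{Lin}$ and $K\preceq L\in\mathcal{L}$ imply $K\in\mathcal{L}$; membership in $\mathcal{L}$ is meant up to isomorphism. A subset $I$ of a linear order $L$ is convex if $x\le_L y\le_L z$ and $x,z\in I$ imply $y\in I$. For $A,B\subseteq L$ write $A\le_L B$ (resp. $A<_L B$) if $a\le_L b$ (resp. $a<_L b$) for all $a\in A$, $b\in B$. A $K$-convex partition of $L$ is a partition $(L_k)_{k\in K}$ of $L$ (into nonempty sets) such that $k<_K k'\iff L_k<_L L_{k'}$. For $L,L'\in\mathrm{LO}$, $L\trianglelefteq^{\mathcal{L}}_{\mathrm{LO}}L'$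 holds iff there are $K\in\mathcal{L}$, a $K$-convex partition $(L_k)_{k\in K}$ of $L$, and an embedding $f$ of $L$ into $L'$ such that $f(L_k)$ is a convex subset of $L'$ for every $k\in K$; we then say that the embedding $f$ witnesses $L\trianglelefteq^{\mathcal{L}}_{\mathrm{LO}}L'$. The space of coloured linear orders is the Polish space $\mathrm{LO}_{\mathbb{N}}=\mathrm{LO}\times\mathbb{N}^{\mathbb{N}}$. For $(L,c),(L',c')\in\mathrm{LO}_{\mathbb{N}}$, $(L,c)\trianglelefteq^{\mathcal{L}}_{\mathrm{LO}_{\mathbb{N}}}(L',c')$ iff there is an embedding $f:L\to L'$ witnessing $L\trianglelefteq^{\mathcal{L}}_{\mathrm{LO}}L'$ with $c'(f(n))=c(n)$ for every $n\in\mathbb{N}$. $\mathcal{L}$ is ccs (closed under convex sums) if for all $K,K'\in\mathcal{L}$ and every family $(K'_k)_{k\in K}$ of nonempty convex subsets of $K'$ such that $k_0<_K k_1\Rightarrow K'_{k_0}\le_{K'}K'_{k_1}$, we have $\sum_{k\in K}K'_k\in\mathcal{L}$, where $\sum_{k\in K}K'_k=\{(x,k): k\in K, x\in K'_k\}$ ordered antilexicographically. For binary relations $E$ on $X$ and $F$ on $Y$, $E\le_B F$ means there is a Borel map $\varphi:X\to Y$ with $x\mathrel{E}x'\iff\varphi(x)\mathrel{F}\varphi(x')$; $E\sim_B F$ means $E\le_B F$ and $F\le_B E$. *)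

(* Defs.v *)
From mathcomp Require Export all_boot all_order all_algebra.
From mathcomp Require Export all_classical all_reals all_analysis.

Set Implicit Arguments.
Unset Strict Implicit.
Unset Printing Implicit Defensive.

Local Open Scope classical_set_scope.

(** Linear orders are given by a (reflexive) boolean relation on an ambient type
    [T]; the carrier of the order is recovered from the diagonal. *)

Definition carrier (T : Type) (r : rel T) : set T := [set x | r x x].

Definition rlt (T : eqType) (r : rel T) (x y : T) : bool := r x y && (x != y).

Definition linear_order (T : Type) (r : rel T) : Prop :=
  [/\ carrier r !=set0,
      forall x y, r x y -> carrier r x /\ carrier r y,
      transitive r,
      antisymmetric r &
      forall x y, carrier r x -> carrier r y -> r x y || r y x].

(** Taking [x = y] shows that [f] maps the carrier of [r] into that of
    [s]; the values of [f] elsewhere are irrelevant. *)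
Definition embedding (T U : Type) (r : rel T) (s : rel U) (f : T -> U) : Prop :=
  forall x y, carrier r x -> carrier r y -> (r x y <-> s (f x) (f y)).

Definition embeds (T U : Type) (r : rel T) (s : rel U) : Prop :=
  exists f : T -> U, embedding r s f.

Definition isomorphic (T U : Type) (r : rel T) (s : rel U) : Prop :=
  exists2 f : T -> U, embedding r s f & f @` carrier r = carrier s.

Definition scattered (T : Type) (r : rel T) : Prop :=
  ~ embeds (fun p q : rat => (p <= q)%R) r.

Definition convex_subset (T : Type) (r : rel T) (I : set T) : Prop :=
  I `<=` carrier r /\
  forall x y z, I x -> I z -> r x y -> r y z -> I y.

Definition set_rle (T : Type) (r : rel T) (A B : set T) : Prop :=
  forall a b, A a -> B b -> r a b.

Definition set_rlt (T : eqType) (r : rel T) (A B : set T) : Prop :=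
  forall a b, A a -> B b -> rlt r a b.

(** [partition D P A] of the library includes that the pieces are nonempty and
    pairwise disjoint for distinct indices. *)
Definition convex_partition (T U : eqType) (k : rel U) (l : rel T)
    (P : U -> set T) : Prop :=
  partition (carrier k) P (carrier l) /\
  forall i j, carrier k i -> carrier k j ->
    (rlt k i j <-> set_rlt l (P i) (P j)).

Definition convex_sum (T U : eqType) (k : rel U) (l : rel T) (P : U -> set T) :
    rel (T * U) :=
  fun a b =>
    [&& k a.2 a.2, k b.2 b.2, a.1 \in P a.2, b.1 \in P b.2 &
        rlt k a.2 b.2 || (a.2 == b.2) && l a.1 b.1].

(** The Cantor space [2 ^ (N x N)], with its product topology. *)
Definition code : topologicalType := {ptws nat * nat -> bool}.

Definition cle (L : code) : rel nat := fun m n => L (m, n).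

Definition LO : set code :=
  [set L | linear_order (cle L) /\ carrier (cle L) = setT].

Definition Fin : set code :=
  [set L | linear_order (cle L) /\ finite_set (carrier (cle L))].

Definition Lin : set code := Fin `|` LO.

Definition Scat : set code := Lin `&` [set L | scattered (cle L)].

Definition downward_closed (C : set code) : Prop :=
  forall K L : code, Lin K -> C L -> embeds (cle K) (cle L) -> C K.

Definition mem_up_to_iso (T : Type) (C : set code) (r : rel T) : Prop :=
  exists2 L : code, C L & isomorphic r (cle L).

Definition ccs (C : set code) : Prop :=
  forall (K K' : code) (P : nat -> set nat),
    C K -> C K' ->
    (forall k, carrier (cle K) k ->
       P k !=set0 /\ convex_subset (cle K') (P k)) ->
    (forall k0 k1, rlt (cle K) k0 k1 -> set_rle (cle K') (P k0) (P k1)) ->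
    mem_up_to_iso C (convex_sum (cle K) (cle K') P).

Definition witnesses (C : set code) (L L' : code) (f : nat -> nat) : Prop :=
  embedding (cle L) (cle L') f /\
  exists (K : code) (P : nat -> set nat),
    [/\ C K, convex_partition (cle K) (cle L) P &
        forall k, carrier (cle K) k -> convex_subset (cle L') (f @` P k)].

(** [LO] as a type carries the subspace topology of [code]. *)
Definition LO_space : topologicalType := LO.

Definition cLO_space : topologicalType := (LO * {ptws nat -> nat})%type.

Definition tri_LO (C : set code) (L L' : LO_space) : Prop :=
  exists f : nat -> nat, witnesses C (set_val L) (set_val L') f.

Definition tri_cLO (C : set code) (L L' : cLO_space) : Prop :=
  exists2 f : nat -> nat, witnesses C (set_val L.1) (set_val L'.1) f &
    forall n, L'.2 (f n) = L.2 n.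

Definition borel_map (X Y : topologicalType) (f : X -> Y) : Prop :=
  forall B : set Y, <<s @open Y >> B -> <<s @open X >> (f @^-1` B).

Definition borel_reducible (X Y : topologicalType)
    (E : X -> X -> Prop) (F : Y -> Y -> Prop) : Prop :=
  exists2 phi : X -> Y, borel_map phi &
    forall x x', E x x' <-> F (phi x) (phi x').

Definition borel_bireducible (X Y : topologicalType)
    (E : X -> X -> Prop) (F : Y -> Y -> Prop) : Prop :=
  borel_reducible E F /\ borel_reducible F E.

(* Main.v *)
Require Import Defs.
From mathcomp Require Import zify lra.

Import Order.TTheory GRing.Theory Num.Theory.

Set Implicit Arguments.
Unset Strict Implicit.
Unset Printing Implicit Defensive.

Local Open Scope classical_set_scope.

(** A linear order [L] is recovered from itself with a constant colouring, so
    only the reduction of the coloured relation to the uncoloured one is of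
    interest.

    Send [(L, c)] to the order [inflate L c] obtained by replacing each point
    [x] of [L] by the sum, over the rationals [q], of a block of order type
    [m + 1 + omega^*], where the natural number [m = tag_code (c x) q] codes
    the pair [(c x, q)] injectively.  The least point of a block, its marker
    [(x, q, 0)], can be recognised locally: markers are exactly the points
    without an immediate predecessor, and the length of the chain of immediate
    successors that starts at a marker is [m], which gives back both [c x] and
    [q].  Hence an isomorphism between convex pieces of two inflated orders
    sends [(x, q, 0)] to some [(y, q, 0)] with [y] of the colour of [x], as
    soon as the piece reaches strictly below and above the block
    ([marker_preserved]); and [y] does not depend on [q]
    ([marker_index_const]).

    An embedding of [L] into [L'] that preserves colours and is convex on the
    pieces of a partition of [L] clearly lifts to the inflated orders
    ([piecewise_inflate]).  Conversely ([piecewise_deflate]), let [f] be an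
    embedding of [inflate L c] into [inflate L' c'] that is convex on the pieces
    of a partition indexed by a scattered [K].  For each [x] some piece contains
    a whole interval of rational copies over [x], as otherwise the rationals
    would embed into [K] ([scattered_piece]).  Choose such a piece, and let
    [g x] be the point of [L'] over which [f] puts these copies.  The map [g]
    is strictly increasing: since [f] preserves the rational coordinate of
    markers, two points [x < x'] with the same image would force two markers
    with equal rational coordinates to the same place.  Grouping the points of
    [L] by their chosen piece gives a convex partition indexed by a suborder of
    [K], hence by an element of the downward closed class, and each group has a
    convex image, as is seen by pulling markers back along [f].

    Finally the triples [(x, q, i)] are enumerated by the natural numbers; each
    bit of the resulting code depends on one bit of [L] and one value of [c],
    so that the reduction is continuous. *)

(** * Linear orders on a whole type *)

(** A linear order whose carrier is the whole ambient type; on codes this is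
    membership in [LO]. *)
Definition full_order (T : Type) (r : rel T) : Prop :=
  linear_order r /\ carrier r = setT.

Section FullOrder.
Context (T : eqType) (r : rel T) (rF : full_order r).

Lemma full_refl x : r x x.
Proof. by case: rF => _ E; have : carrier r x by rewrite E. Qed.

Lemma full_trans y x z : r x y -> r y z -> r x z.
Proof. by case: rF => -[_ _ + _ _ _]; apply. Qed.

Lemma full_anti x y : r x y -> r y x -> x = y.
Proof. by case: rF => -[_ _ _ + _ _] h1 h2; apply; rewrite h1. Qed.

Lemma full_total x y : r x y || r y x.
Proof. by case: rF => -[_ _ _ _ +] E; rewrite E; apply. Qed.

Lemma full_ltNge x y : rlt r x y = ~~ r y x.
Proof.
rewrite /rlt; have [<-|nxy] := eqVneq x y; first by rewrite andbF full_refl.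
rewrite andbT; have := full_total x y.
case: (boolP (r x y)) => //= rxy; case: (boolP (r y x)) => // ryx _.
by rewrite (full_anti rxy ryx) eqxx in nxy.
Qed.

Lemma full_ltW x y : rlt r x y -> r x y.
Proof. by case/andP. Qed.

Lemma full_ltxx x : rlt r x x = false.
Proof. by rewrite /rlt eqxx andbF. Qed.

Lemma full_lt_le y x z : rlt r x y -> r y z -> rlt r x z.
Proof.
rewrite !full_ltNge => + yz; apply: contra => zx; exact: full_trans yz zx.
Qed.

Lemma full_lt_trans y x z : rlt r x y -> rlt r y z -> rlt r x z.
Proof. by move=> h /full_ltW; apply: full_lt_le. Qed.

Lemma full_leVlt x y : r x y -> x = y \/ rlt r x y.
Proof.
by move=> h; rewrite /rlt h; have [->|] := eqVneq x y; [left|right].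
Qed.

End FullOrder.

Lemma full_orderI (T : eqType) (r : rel T) (t0 : T) :
  reflexive r -> transitive r -> antisymmetric r -> total r -> full_order r.
Proof.
move=> re tr an to; split; last by apply/seteqP; split => // x _; exact: re.
split=> //; first by exists t0; exact: re.
by move=> x y _; split; exact: re.
Qed.

(** Sum of the orders [s x] along [r]: lexicographic, the first coordinate
    being dominant. *)
Definition lexi_le (T U : eqType) (r : rel T) (s : T -> rel U) : rel (T * U) :=
  fun a b => if a.1 == b.1 then s a.1 a.2 b.2 else r a.1 b.1.

Lemma lexi_full (T U : eqType) (r : rel T) (s : T -> rel U) :
  full_order r -> (forall x, full_order (s x)) -> full_order (lexi_le r s).
Proof.
move=> rF sF.
have [t _] : carrier r !=set0 by case: rF => -[].
have [u _] : carrier (s t) !=set0 by case: (sF t) => -[].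
apply: (@full_orderI _ _ (t, u)).
- by move=> [x i]; rewrite /lexi_le /= eqxx full_refl.
- move=> [y j] [x i] [z k]; rewrite /lexi_le /=.
  have [<-|nxy] := eqVneq x y.
    by have [_|//] := eqVneq x z; exact: full_trans.
  have [<-|nyz] := eqVneq y z; first by rewrite (negbTE nxy).
  move=> h1 h2; have [E|_] := eqVneq x z; last exact: full_trans h1 h2.
  by rewrite -E in h2; rewrite (full_anti rF h1 h2) eqxx in nxy.
- move=> [x i] [y j]; rewrite /lexi_le /= eq_sym.
  have [->|nxy] := eqVneq y x.
    by case/andP => h1 h2; rewrite (full_anti (sF x) h1 h2).
  by case/andP => h1 h2; rewrite (full_anti rF h1 h2) eqxx in nxy.
- move=> [x i] [y j]; rewrite /lexi_le /= (eq_sym y).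
  by have [->|_] := eqVneq x y; exact: full_total.
Qed.

Lemma lexi_lt (T U : eqType) (r : rel T) (s : T -> rel U) x i y j :
  rlt (lexi_le r s) (x, i) (y, j) = if x == y then rlt (s x) i j else rlt r x y.
Proof.
rewrite /rlt /lexi_le /= xpair_eqE negb_and.
by have [->|] := eqVneq x y.
Qed.

Lemma lexi_le_fst (T U : eqType) (r : rel T) (s : T -> rel U) a b :
  full_order r -> lexi_le r s a b -> r a.1 b.1.
Proof.
by move=> rF; rewrite /lexi_le; have [->|] := eqVneq a.1 b.1; rewrite ?full_refl.
Qed.

(** * The inflated order *)

(** An order of type [m + 1 + omega^*] on the natural numbers:
    [0 < 1 < ... < m < ... < m + 2 < m + 1].  Using all natural numbers whatever
    [m] is keeps the domain of the inflated order independent of the colours. *)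
Definition block_le (m : nat) : rel nat :=
  fun i j => if i <= m then i <= j else (m < j) && (j <= i).

Lemma block_full m : full_order (block_le m).
Proof.
apply: (@full_orderI _ _ 0).
- by move=> i; rewrite /block_le; case: leqP => /=; lia.
- by move=> j i k; rewrite /block_le; case: (leqP i m); case: (leqP j m); lia.
- by move=> i j; rewrite /block_le; case: (leqP i m); case: (leqP j m); lia.
- by move=> i j; rewrite /block_le; case: (leqP i m); case: (leqP j m); lia.
Qed.

Lemma block_lt m i j :
  rlt (block_le m) i j = if i <= m then i < j else (m < j) && (j < i).
Proof. by rewrite /rlt /block_le; case: (leqP i m); lia. Qed.

Lemma rat_full : full_order (fun p q : rat => (p <= q)%R).
Proof.
apply: (@full_orderI _ _ (0 : rat)%R).
- exact: lexx.
- exact: le_trans.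
- exact: le_anti.
- exact: le_total.
Qed.

(** A point [(x, q, i)]: the [i]-th element of the block at the rational [q]
    over the point [x] of the original order. *)
Local Notation point := (nat * rat * nat)%type.

(** The length parameter of the block at [q] over a point of colour [k]; it is
    injective in the pair [(k, q)]. *)
Definition tag_code (k : nat) (q : rat) : nat := pickle (k, q).

(** The inflated order of the order [l] coloured by [c]. *)
Definition inflate (l : rel nat) (c : nat -> nat) : rel point :=
  lexi_le (lexi_le l (fun _ p q => (p <= q)%R))
          (fun p => block_le (tag_code (c p.1) p.2)).

(** [b] is the immediate successor of [a]. *)
Definition covers (T : eqType) (r : rel T) (a b : T) : Prop :=
  rlt r a b /\ forall d, rlt r a d -> rlt r d b -> False.

Lemma covers_uniq (T : eqType) (r : rel T) a b b' : full_order r ->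
  covers r a b -> covers r a b' -> b = b'.
Proof.
move=> rF [ab nb] [ab' nb']; case/orP: (full_total rF b b') => /full_leVlt.
  by case=> // /(nb' _ ab).
by case=> // /(nb _ ab').
Qed.

Section Inflate.
Context (l : rel nat) (c : nat -> nat) (lF : full_order l).
Notation R := (inflate l c).

Lemma inflate_full : full_order R.
Proof.
apply: lexi_full => [|p]; last exact: block_full.
by apply: lexi_full => // _; exact: rat_full.
Qed.

Lemma inflate_ltE x q i y r j : rlt R (x, q, i) (y, r, j) =
  if x == y then
    if q == r then rlt (block_le (tag_code (c x) q)) i j else (q < r)%R
  else rlt l x y.
Proof.
rewrite lexi_lt /= xpair_eqE lexi_lt; case: eqVneq => //= _.
by case: eqVneq => //= nqr; rewrite lt_def /rlt nqr andbT eq_sym nqr.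
Qed.

Lemma inflate_lt_index x q i y r j : rlt l x y -> rlt R (x, q, i) (y, r, j).
Proof.
by rewrite inflate_ltE => h; case: eqVneq h => // ->; rewrite full_ltxx.
Qed.

Lemma inflate_lt_rat x q i r j : (q < r)%R -> rlt R (x, q, i) (x, r, j).
Proof. by rewrite inflate_ltE eqxx => h; rewrite h lt_eqF. Qed.

Lemma inflate_lt_block x q i j :
  rlt R (x, q, i) (x, q, j) = rlt (block_le (tag_code (c x) q)) i j.
Proof. by rewrite inflate_ltE !eqxx. Qed.

Lemma inflate_ltP x q i y r j : rlt R (x, q, i) (y, r, j) ->
  [\/ rlt l x y, x = y /\ (q < r)%R |
      [/\ x = y, q = r & rlt (block_le (tag_code (c x) q)) i j]].
Proof.
rewrite inflate_ltE; case: eqVneq => [->|_]; last by constructor 1.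
by case: eqVneq => [->|_] h; [constructor 3|constructor 2].
Qed.

Lemma inflate_le_index a b : R a b -> l a.1.1 b.1.1.
Proof.
move=> /lexi_le_fst H; have := H (lexi_full lF (fun _ => rat_full)).
exact: lexi_le_fst.
Qed.

Lemma inflate_lt_rat0 x q r i : rlt R (x, q, i) (x, r, 0) -> (q < r)%R.
Proof.
case/inflate_ltP => [|[]//|[_ _]]; first by rewrite full_ltxx.
by rewrite block_lt !ltn0 if_same.
Qed.

(** A marker has no immediate predecessor. *)
Lemma inflate_lt0 x q b :
  rlt R b (x, q, 0) -> exists d, rlt R b d /\ rlt R d (x, q, 0).
Proof.
case: b => -[y r] j /inflate_ltP[yx|[-> rq]|[_ _]].
- exists (x, (q - 1)%R, 0); split; first exact: inflate_lt_index.
  by apply: inflate_lt_rat; lra.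
- exists (x, ((r + q) / 2)%R, 0); split; apply: inflate_lt_rat; lra.
- by rewrite block_lt !ltn0 if_same.
Qed.

(** The last point of the finite part of a block has no immediate successor,
    since [omega^*] has no least element. *)
Lemma inflate_gt_last x q b : let m := tag_code (c x) q in
  rlt R (x, q, m) b -> exists d, rlt R (x, q, m) d /\ rlt R d b.
Proof.
case: b => -[y r] j m /inflate_ltP[xy|[<- qr]|[<- <-]].
- exists (x, q, m.+1); split; last exact: inflate_lt_index.
  by rewrite inflate_lt_block block_lt -/m leqnn.
- exists (x, q, m.+1); split; last exact: inflate_lt_rat.
  by rewrite inflate_lt_block block_lt -/m leqnn.
- rewrite block_lt leqnn -/m => mj; exists (x, q, j.+1).
  by rewrite !inflate_lt_block !block_lt -/m leqnn; case: (leqP j.+1 m); lia.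
Qed.

Lemma inflate_block_covers x q i j : rlt (block_le (tag_code (c x) q)) i j ->
  (forall k, rlt (block_le (tag_code (c x) q)) i k ->
     rlt (block_le (tag_code (c x) q)) k j -> False) ->
  covers R (x, q, i) (x, q, j).
Proof.
move=> ij nk; split=> [|[[y r] k]]; first by rewrite inflate_lt_block.
case/inflate_ltP => [xy|[<- qr]|[<- <- ik]].
- case/inflate_ltP => [yx|[yx _]|[yx _ _]].
  + by have := full_lt_trans lF xy yx; rewrite full_ltxx.
  + by rewrite yx full_ltxx in xy.
  + by rewrite yx full_ltxx in xy.
- by case/inflate_ltP => [|[_]|[_]]; rewrite ?full_ltxx//; [lra|move=> E; lra].
- by rewrite inflate_lt_block; exact: nk.
Qed.

Lemma inflate_covers_S x q i :
  i < tag_code (c x) q -> covers R (x, q, i) (x, q, i.+1).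
Proof.
move=> im; apply: inflate_block_covers => [|k]; rewrite !block_lt (ltnW im) //.
by case: (leqP k (tag_code (c x) q)); lia.
Qed.

(** Only markers lack an immediate predecessor. *)
Lemma inflate_pred x q i : i != 0 -> exists b, covers R b (x, q, i).
Proof.
move=> i0; have [im|mi] := leqP i (tag_code (c x) q).
  (* in the finite part the immediate predecessor is [i - 1] ... *)
  exists (x, q, i.-1).
  rewrite -[in X in covers _ _ X](prednK (n := i)); last lia.
  by apply: inflate_covers_S; lia.
(* ... and in the reversed part it is [i + 1] *)
exists (x, q, i.+1); apply: inflate_block_covers => [|k]; rewrite !block_lt.
  by case: (leqP i.+1 (tag_code (c x) q)); lia.
case: (leqP i.+1 (tag_code (c x) q)) => [|_]; first lia.
by case: (leqP k (tag_code (c x) q)); lia.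
Qed.

End Inflate.

(** * Isomorphisms between convex pieces *)

(** [f] restricts to an isomorphism of the convex set [M] of [r] onto a convex
    set of [s]; outside of [M] it is arbitrary. *)
Definition piece_iso (T U : eqType) (r : rel T) (s : rel U) (M : set T)
    (f : T -> U) : Prop :=
  [/\ convex_subset r M, convex_subset s (f @` M) &
      forall a b, M a -> M b -> (r a b <-> s (f a) (f b))].

Section PieceIso.
Context (T U : eqType) (r : rel T) (s : rel U).
Context (rF : full_order r) (sF : full_order s).
Context (M : set T) (f : T -> U) (Mf : piece_iso r s M f).

Lemma piece_le a b : M a -> M b -> r a b = s (f a) (f b).
Proof. by case: Mf => _ _ H Ma Mb; apply/idP/idP => /(H _ _ Ma Mb). Qed.

Lemma piece_lt a b : M a -> M b -> rlt r a b = rlt s (f a) (f b).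
Proof. by move=> Ma Mb; rewrite !full_ltNge// (piece_le Mb Ma). Qed.

Lemma piece_inj a b : M a -> M b -> f a = f b -> a = b.
Proof.
move=> Ma Mb E; apply: (full_anti rF).
  by rewrite (piece_le Ma Mb) E full_refl.
by rewrite (piece_le Mb Ma) E full_refl.
Qed.

Lemma piece_between a b d : M a -> M b -> s (f a) d -> s d (f b) ->
  exists2 e, M e & f e = d.
Proof.
case: Mf => _ [_ H] _ Ma Mb ad db.
by have [e Me <-] := H (f a) d (f b) (imageP f Ma) (imageP f Mb) ad db; exists e.
Qed.

Lemma piece_mid a b d : M a -> M b -> r a d -> r d b -> M d.
Proof. by case: Mf => -[_ H] _ _; exact: H. Qed.

Lemma piece_covers a b : M a -> M b -> covers r a b -> covers s (f a) (f b).
Proof.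
move=> Ma Mb [ab nab]; split=> [|d ad db]; first by rewrite -piece_lt.
have [e Me E] := piece_between Ma Mb (full_ltW ad) (full_ltW db); subst d.
by rewrite -!piece_lt// in ad db; exact: nab db.
Qed.

(** The point [p] witnesses that [a] is not the least point of the piece;
    otherwise the image of [a] could have an immediate predecessor outside of
    the image of the piece. *)
Lemma piece_no_pred p a : M p -> M a -> rlt r p a ->
  (forall b, rlt r b a -> exists d, rlt r b d /\ rlt r d a) ->
  forall b, ~ covers s b (f a).
Proof.
move=> Mp Ma pa H b' [ba nba].
have pb : s (f p) b'.
  case/orP: (full_total sF (f p) b') => // bp.
  rewrite (piece_lt Mp Ma) in pa.
  by case: (full_leVlt bp) => [->|/nba/(_ pa)//]; exact: full_refl.
have [b Mb E] := piece_between Mp Ma pb (full_ltW ba); subst b'.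
rewrite -piece_lt// in ba; have [d [bd da]] := H _ ba.
have Md := piece_mid Mb Ma (full_ltW bd) (full_ltW da).
by apply: (nba (f d)); rewrite -piece_lt.
Qed.

Lemma piece_no_succ a p : M a -> M p -> rlt r a p ->
  (forall b, rlt r a b -> exists d, rlt r a d /\ rlt r d b) ->
  forall b, ~ covers s (f a) b.
Proof.
move=> Ma Mp pa H b' [ba nba].
have pb : s b' (f p).
  case/orP: (full_total sF b' (f p)) => // bp.
  rewrite (piece_lt Ma Mp) in pa.
  by case: (full_leVlt bp) => [->|/(nba _ pa)//]; exact: full_refl.
have [b Mb E] := piece_between Ma Mp (full_ltW ba) pb; subst b'.
rewrite -piece_lt// in ba; have [d [bd da]] := H _ ba.
have Md := piece_mid Ma Mb (full_ltW bd) (full_ltW da).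
by apply: (nba (f d)); rewrite -piece_lt.
Qed.

(** [t0] only serves as a default value outside of the image of [M]. *)
Lemma piece_inv (t0 : T) : exists2 g : U -> T,
  piece_iso s r (f @` M) g & forall a, M a -> g (f a) = a.
Proof.
have /choice[g gP] : forall u, exists a, (exists2 b, M b & f b = u) ->
    M a /\ f a = u.
  move=> u; have [[b Mb E]|nE] := pselect (exists2 b, M b & f b = u).
    by exists b.
  by exists t0 => /nE.
have gf a : M a -> g (f a) = a.
  move=> Ma; have [|Mg E] := gP (f a); first by exists a.
  exact: piece_inj.
exists g => //; case: (Mf) => MC fC _; split=> //.
- suff -> : g @` (f @` M) = M by [].
  apply/seteqP; split => [_ [_ [a Ma <-] <-]|a Ma]; first by rewrite gf.
  by exists (f a); [exists a|exact: gf].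
- by move=> _ _ [a Ma <-] [b Mb <-]; rewrite !gf// -piece_le.
Qed.

End PieceIso.

(** * Markers under piecewise isomorphisms *)

Section Marker.
Context (l l' : rel nat) (c c' : nat -> nat).
Context (lF : full_order l) (lF' : full_order l').
Notation R := (inflate l c).
Notation R' := (inflate l' c').

(** A piece isomorphism preserves the rational coordinate and the colour of a
    marker whose block lies strictly between two points [p] and [t] of the
    piece. *)
Lemma marker_preserved (M : set point) f p x q t :
  piece_iso R R' M f -> M p -> M t -> rlt R p (x, q, 0) ->
  (forall i, rlt R (x, q, i) t) ->
  exists x', f (x, q, 0) = (x', q, 0) /\ c' x' = c x.
Proof.
move=> Mf Mp Mt p0 lt_t.
have RF := inflate_full c lF; have RF' := inflate_full c' lF'.
set m := tag_code (c x) q.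
have Mi i : M (x, q, i).
  apply: (piece_mid Mf Mp Mt); last exact: full_ltW (lt_t i).
  apply: full_ltW; have [->//|i0] := eqVneq i 0.
  apply: (full_lt_trans RF p0).
  by rewrite inflate_lt_block block_lt leq0n lt0n.
case E0: (f (x, q, 0)) => [[x' q'] i'].
have Ei' : i' = 0.
  apply/eqP; apply/negP => /negP/(inflate_pred c' lF' x' q')[b].
  rewrite -E0; apply: (piece_no_pred RF RF' Mf Mp (Mi 0) p0).
  by move=> b'; exact: inflate_lt0.
subst i'; set m' := tag_code (c' x') q'.
(* the image of the finite chain of the block is an initial segment of the
   finite chain of the target block *)
have Hi i : i <= m -> i <= m' /\ f (x, q, i) = (x', q', i).
  elim: i => [//|i IH] im; have [im' Ei] := IH (ltnW im).
  have /(piece_covers RF RF' Mf (Mi i) (Mi i.+1)) := inflate_covers_S lF im.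
  rewrite Ei; have [lim'|mi'] := ltnP i m'.
    have cS := inflate_covers_S lF' lim'.
    by move=> cf; split=> //; exact: covers_uniq RF' cf cS.
  have -> : i = m' by apply/eqP; rewrite eqn_leq im'.
  by case=> h1 h2; have [d [/h2 h /h]] := inflate_gt_last h1.
have [mm' Em] := Hi m (leqnn m).
(* and it is all of it, since the last point has no immediate successor *)
have Emm : m' = m.
  apply/eqP; rewrite eqn_leq mm' andbT leqNgt.
  apply/negP => /(inflate_covers_S lF').
  rewrite -Em; apply: (piece_no_succ RF RF' Mf (Mi m) Mt (lt_t m)) => b.
  exact: inflate_gt_last.
have /(pcan_inj pickleK) [Ec Eq] : pickle (c' x', q') = pickle (c x, q) := Emm.
by exists x'; rewrite Ec Eq.
Qed.

End Marker.

(** * Scattered convex partitions *)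

Lemma rat_embeds_interval (a b : rat) : (a < b)%R ->
  exists2 u : rat -> rat, {mono u : p q / (p <= q)%R} &
    forall p, (a < u p < b)%R.
Proof.
move=> ab.
(* an increasing map of the rationals into the interval from 0 to 2 *)
pose v (p : rat) := (if 0 <= p then 2 - (1 + p)^-1 else (1 - p)^-1)%R.
have pos (p : rat) : (0 <= p -> 0 < (1 + p)^-1 <= 1)%R.
  by move=> p0; rewrite invr_gt0 invf_le1; lra.
have neg (p : rat) : (p < 0 -> 0 < (1 - p)^-1 < 1)%R.
  by move=> p0; rewrite invr_gt0 invf_lt1; lra.
have v02 p : (0 < v p < 2)%R.
  by rewrite /v; case: (leP 0 p)%R => [/pos|/neg]; lra.
have vlt p q : (p < q -> v p < v q)%R.
  move=> pq; rewrite /v; case: (leP 0 p)%R => p0; case: (leP 0 q)%R => q0.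
  - have : ((1 + q)^-1 < (1 + p)^-1)%R by rewrite ltf_pV2 ?posrE; lra.
    lra.
  - lra.
  - by have := pos _ q0; have := neg _ p0; lra.
  - by rewrite ltf_pV2 ?posrE; lra.
exists (fun p => a + (b - a) / 2 * v p)%R.
  by apply: le_mono => p q /vlt h; rewrite ltrD2l ltr_pM2l//; lra.
move=> p; have /andP[v0 v2] := v02 p.
have d0 : (0 < (b - a) / 2)%R by lra.
have := mulr_gt0 d0 v0.
have : ((b - a) / 2 * v p < (b - a) / 2 * 2)%R by rewrite ltr_pM2l.
lra.
Qed.

Section Pieces.
Context (T : eqType) (k : rel nat) (l : rel T) (P : nat -> set T).
Context (kL : linear_order k) (lF : full_order l).
Context (kP : convex_partition k l P).

Lemma piece_ex x : exists2 i, carrier k i & P i x.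
Proof.
case: kP => -[E _ _] _; have : carrier l x by case: lF => _ ->.
by rewrite -E => -[i]; exists i.
Qed.

Lemma piece_uniq i j x : carrier k i -> carrier k j -> P i x -> P j x -> i = j.
Proof. by case: kP => -[_ tr _] _ ki kj Pi Pj; apply: tr ki kj _; exists x. Qed.

Lemma piece_lt_index i j x y : carrier k i -> carrier k j -> P i x -> P j y ->
  rlt l x y -> k i j.
Proof.
move=> ki kj Pi Pj xy; case: (kL) => _ _ _ _ /(_ _ _ ki kj)/orP[//|ji].
have [->//|nij] := eqVneq i j; have ltji : rlt k j i by rewrite /rlt ji eq_sym.
have /(_ _ _ Pj Pi) yx := (kP.2 j i kj ki).1 ltji.
by have := full_lt_trans lF xy yx; rewrite full_ltxx.
Qed.

Lemma partition_convex i : carrier k i -> convex_subset l (P i).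
Proof.
move=> ki; split=> [x _|x y z Px Pz xy yz]; first by case: lF => _ ->.
have [j kj Py] := piece_ex y.
have [xy'|xy'] := full_leVlt xy; first by rewrite -xy'.
have [yz'|yz'] := full_leVlt yz; first by rewrite yz'.
have ij := piece_lt_index ki kj Px Py xy'.
have ji := piece_lt_index kj ki Py Pz yz'.
by case: kL => _ _ _ /(_ i j) -> //; rewrite ij.
Qed.

End Pieces.

(** A nonempty suborder [A] of a member [K] of a downward closed class is
    isomorphic, by some [e], to a member of the class. *)
Lemma downward_suborder (C : set code) (K : code) (A : set nat) :
  downward_closed C -> C K -> linear_order (cle K) ->
  A `<=` carrier (cle K) -> A !=set0 ->
  exists (K1 : code) (e : nat -> nat), [/\ C K1, linear_order (cle K1),
    set_bij (carrier (cle K1)) A e &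
    forall i j, carrier (cle K1) i -> carrier (cle K1) j ->
      cle K1 i j = cle K (e i) (e j)].
Proof.
move=> hd CK KL AK [a0 Aa0].
have [nK cK tK aK toK] := KL.
(* codes have a finite domain or the whole of the natural numbers as domain:
   an infinite [A] has to be enumerated *)
have [finA|infA] := pselect (finite_set A).
  pose K1 : code := fun p => [&& p.1 \in A, p.2 \in A & cle K p.1 p.2].
  have K1E : carrier (cle K1) = A.
    apply/seteqP; split=> [x|x Ax]; first by move=> /and3P[/set_mem].
    by apply/and3P; rewrite inE; split=> //; exact: AK.
  have L1 : linear_order (cle K1).
    split; rewrite ?K1E; first by exists a0.
    - by move=> x y /and3P[/set_mem ? /set_mem ? _].
    - move=> y x z /and3P[xA _ xy] /and3P[_ zA yz].
      by apply/and3P; split=> //; exact: tK xy yz.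
    - by move=> x y /andP[/and3P[_ _ xy] /and3P[_ _ yx]]; apply: aK; rewrite xy.
    - move=> x y Ax Ay; rewrite /cle /K1 /= !mem_set//=.
      by apply: toK; exact: AK.
  have emb i j : carrier (cle K1) i -> carrier (cle K1) j ->
      cle K1 i j = cle K i j.
    by rewrite K1E => Ai Aj; rewrite {1}/cle /K1 /= !mem_set.
  exists K1, id; split=> //; last by rewrite K1E; split=> // x Ax; exists x.
  apply: hd CK _; first by left; split=> //; rewrite K1E.
  by exists id => i j ki kj; rewrite emb.
have /card_esym/card_set_bijP[e bije] := eq_card_nat (countableP A) infA.
have [eA einj esurj] := bije.
have ek i : carrier (cle K) (e i) by apply: AK; exact: eA.
pose K1 : code := fun p => cle K (e p.1) (e p.2).
have F1 : full_order (cle K1).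
  apply: (@full_orderI _ _ 0).
  - by move=> x; exact: ek.
  - by move=> y x z; exact: tK.
  - by move=> x y /aK; apply: einj; rewrite inE.
  - by move=> x y; exact: toK.
exists K1, e; rewrite F1.2; split=> //; last exact: F1.1.
by apply: hd CK _; [right|exists e].
Qed.

(** * Families of markers over one point *)

Section MarkerInterval.
Context (l l' : rel nat) (c c' : nat -> nat).
Context (lF : full_order l) (lF' : full_order l').
Notation R := (inflate l c).
Notation R' := (inflate l' c').
Context (M : set point) (f : point -> point) (Mf : piece_iso R R' M f).

Let RF := inflate_full c lF.
Let RF' := inflate_full c' lF'.

(** Were [y < y'], the marker at [q' + 1] over [y] would be the image of a marker
    at [q' + 1] over [x] that lies below the marker [(x, q', 0)]. *)
Lemma marker_index_const x q q' y y' : M (x, q, 0) -> M (x, q', 0) ->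
  (q < q')%R -> f (x, q, 0) = (y, q, 0) -> f (x, q', 0) = (y', q', 0) -> y = y'.
Proof.
move=> Mq Mq' qq' fq fq'.
have lt1 : rlt R (x, q, 0) (x, q', 0) by exact: inflate_lt_rat.
have : l' y y'.
  move: (lt1); rewrite (piece_lt RF RF' Mf Mq Mq') fq fq' => /full_ltW.
  exact: inflate_le_index.
move=> /full_leVlt[//|yy'].
have b1 : rlt R' (f (x, q, 0)) (y, (q' + 1)%R, 0).
  by rewrite fq; apply: inflate_lt_rat; lra.
have b2 : rlt R' (y, (q' + 1)%R, 0) (f (x, q', 0)).
  by rewrite fq'; exact: inflate_lt_index.
have [e Me fe] := piece_between Mf Mq Mq' (full_ltW b1) (full_ltW b2).
have [h hf hK] := piece_inv RF RF' Mf e.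
have [|z [hz _]] := marker_preserved lF' lF hf (imageP f Mq) (imageP f Mq') b1.
  by move=> i; rewrite fq'; exact: inflate_lt_index.
have {}hz : e = (z, (q' + 1)%R, 0) by rewrite -hz -fe hK.
rewrite -fe -!(piece_lt RF RF' Mf)// hz in b1 b2.
have xz := inflate_le_index lF (full_ltW b1).
have zx := inflate_le_index lF (full_ltW b2).
move: b2; rewrite (full_anti lF xz zx : x = z) => /inflate_lt_rat0.
by rewrite ltNge lerDl ler01.
Qed.

Lemma marker_interval x a b : (a < b)%R -> M (x, a, 0) -> M (x, b, 0) ->
  exists2 y, c' y = c x & forall q, (a < q < b)%R ->
    M (x, q, 0) /\ f (x, q, 0) = (y, q, 0).
Proof.
move=> ab Ma Mb.
have H q : (a < q < b)%R -> M (x, q, 0) /\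
    exists y, f (x, q, 0) = (y, q, 0) /\ c' y = c x.
  move=> /andP[aq qb]; have la := inflate_lt_rat l c x 0 0 aq.
  split; last first.
    apply: (marker_preserved lF lF' Mf Ma Mb la) => i.
    exact: inflate_lt_rat.
  have lb := inflate_lt_rat l c x 0 0 qb.
  exact: (piece_mid Mf Ma Mb (full_ltW la) (full_ltW lb)).
have mid : (a < (a + b) / 2 < b)%R by lra.
have [Mm [y [fy cy]]] := H _ mid; exists y => // q qab.
have [Mq [y' [fy' _]]] := H _ qab; split=> //.
case: (ltgtP q ((a + b) / 2)%R) => [lt|lt|->//]; rewrite fy'; congr (_, _, _).
  exact: marker_index_const Mq Mm lt fy' fy.
by have := marker_index_const Mm Mq lt fy fy'.
Qed.

End MarkerInterval.

(** * Descending from inflated orders *)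

(** [witnesses] for arbitrary ambient types: [f] embeds [r] into [s] and is
    convex on the pieces of a convex partition indexed by a member of [C]. *)
Definition piecewise (C : set code) (T U : eqType) (r : rel T) (s : rel U)
    (f : T -> U) : Prop :=
  embedding r s f /\
  exists (K : code) (P : nat -> set T),
    [/\ C K, convex_partition (cle K) r P &
        forall k, carrier (cle K) k -> convex_subset s (f @` P k)].

Section Deflate.
Context (C : set code) (hScat : C `<=` Scat) (hdown : downward_closed C).
Context (l l' : rel nat) (c c' : nat -> nat).
Context (lF : full_order l) (lF' : full_order l').
Notation R := (inflate l c).
Notation R' := (inflate l' c').

Let RF := inflate_full c lF.
Let RF' := inflate_full c' lF'.

(** Some piece contains two markers over [x] with rational coordinates between
    [a] and [b]: otherwise distinct markers lie in distinct pieces, and the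
    rationals embed into [K]. *)
Lemma scattered_piece (K : code) (P : nat -> set point) x a b :
  scattered (cle K) -> linear_order (cle K) -> convex_partition (cle K) R P ->
  (a < b)%R -> exists k q1 q2, carrier (cle K) k /\
    [/\ (a < q1)%R, (q1 < q2)%R, (q2 < b)%R, P k (x, q1, 0) & P k (x, q2, 0)].
Proof.
move=> Ks KL KP ab; apply: contrapT => no; apply: Ks.
have [u umono uab] := rat_embeds_interval ab.
have /choice[h hP] p : exists k, carrier (cle K) k /\ P k (x, u p, 0).
  by have [k kk Pk] := piece_ex RF KP (x, u p, 0); exists k.
have ult p q : (p < q -> u p < u q)%R by rewrite (leW_mono umono).
have hlt p q : (p < q)%R -> rlt (cle K) (h p) (h q).
  move=> pq; have [kp Pp] := hP p; have [kq Pq] := hP q.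
  have lpq : rlt R (x, u p, 0) (x, u q, 0) by exact/inflate_lt_rat/ult.
  rewrite /rlt (piece_lt_index KL RF KP kp kq Pp Pq lpq) /=.
  apply/eqP => E; apply: no; exists (h p), (u p), (u q); split=> //.
  have /andP[? _] := uab p; have /andP[_ ?] := uab q.
  by rewrite E in Pp *; split=> //; exact: ult.
exists h => p q _ _; split.
  rewrite le_eqVlt => /orP[/eqP->|/hlt/full_ltW//].
  by case: (hP q).
move=> hpq; rewrite leNgt; apply/negP => /hlt/andP[hqp /eqP].
by case: KL => _ _ _ aK _; apply; apply: aK; rewrite hqp.
Qed.

Lemma piecewise_deflate (f : point -> point) : piecewise C R R' f ->
  exists2 g : nat -> nat, piecewise C l l' g & forall x, c' (g x) = c x.
Proof.
case=> femb [K [P [CK KP Pc]]].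
have [_ Ks] := hScat CK.
have KL : linear_order (cle K) by case: (hScat CK) => -[[]|[]].
have Rfull a : carrier R a by rewrite RF.2.
have fle a b : R a b = R' (f a) (f b).
  by apply/idP/idP => /(femb a b (Rfull a) (Rfull b)).
have flt a b : rlt R a b = rlt R' (f a) (f b).
  by rewrite !full_ltNge// fle.
have piso k : carrier (cle K) k -> piece_iso R R' (P k) f.
  move=> kk; split; [exact: partition_convex KL RF KP k kk|exact: Pc|].
  by move=> a b _ _; exact: femb.
(* for each [x], a piece [k] that contains the markers over [x] at [a] and [b] *)
have /choice[kq kqP] x : exists t : nat * rat * rat, let: (k, a, b) := t in
    [/\ carrier (cle K) k, (a < b)%R, P k (x, a, 0) & P k (x, b, 0)].
  have [k [a [b [kk [_ ab _ Pa Pb]]]]] := scattered_piece x Ks KL KP ltr01.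
  by exists (k, a, b).
pose ki x := (kq x).1.1; pose qa x := (kq x).1.2; pose qb x := (kq x).2.
have kiP x : [/\ carrier (cle K) (ki x), (qa x < qb x)%R, P (ki x) (x, qa x, 0)
    & P (ki x) (x, qb x, 0)].
  by have := kqP x; rewrite /ki /qa /qb; case: (kq x) => -[].
have /choice[g gP] x : exists y, c' y = c x /\ forall q, (qa x < q < qb x)%R ->
    P (ki x) (x, q, 0) /\ f (x, q, 0) = (y, q, 0).
  have [kk ab Pa Pb] := kiP x.
  by have [y] := marker_interval lF lF' (piso _ kk) ab Pa Pb; exists y.
pose mid x := ((qa x + qb x) / 2)%R.
have midP x : (qa x < mid x < qb x)%R.
  by have [_ ab _ _] := kiP x; rewrite /mid; lra.
have Pmid x : P (ki x) (x, mid x, 0) by have [_ /(_ _ (midP x))[]] := gP x.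
have fmid x : f (x, mid x, 0) = (g x, mid x, 0).
  by have [_ /(_ _ (midP x))[]] := gP x.
have glt x x' : rlt l x x' -> rlt l' (g x) (g x').
  move=> xx'; have : l' (g x) (g x').
    have : R (x, mid x, 0) (x', mid x', 0) by exact/full_ltW/inflate_lt_index.
    by rewrite fle !fmid => /(inflate_le_index lF').
  case/full_leVlt => // Eg.
  (* suppose that [x] and [x'] have the same image: a marker over [x'] at some
     [q] in the interval chosen for [x] is squeezed into the image of [x], where
     it collides with the image of the marker over [x] at [q] *)
  have [kx ab _ _] := kiP x.
  have [k [a [b [kk [qa1 ab' qb1 Pa Pb]]]]] := scattered_piece x' Ks KL KP ab.
  have [y _ yP] := marker_interval lF lF' (piso _ kk) ab' Pa Pb.
  pose q := ((a + b) / 2)%R.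
  have qab : (a < q < b)%R by rewrite /q; lra.
  have [_ fq'] := yP q qab.
  have [_ /(_ q)[|_ fq]] := gP x; first lra.
  have qmid : (q < mid x')%R.
    have : rlt R (x, q, 0) (x', mid x', 0) by exact: inflate_lt_index.
    by rewrite flt fq fmid Eg => /inflate_lt_rat0.
  have Ey : y = g x.
    apply: (full_anti lF').
      have : R (x', q, 0) (x', mid x', 0) by exact/full_ltW/inflate_lt_rat.
      by rewrite fle fq' fmid Eg => /(inflate_le_index lF').
    have : R (x, q, 0) (x', q, 0) by exact/full_ltW/inflate_lt_index.
    by rewrite fle fq fq' => /(inflate_le_index lF').
  have : rlt R (x, q, 0) (x', q, 0) by exact: inflate_lt_index.
  by rewrite flt fq fq' Ey full_ltxx.
exists g; last by move=> x; have [] := gP x.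
have gle x y : l x y = l' (g x) (g y).
  apply/idP/idP.
    by case/full_leVlt => [->|/glt/full_ltW//]; exact: full_refl.
  apply: contraLR; rewrite -!full_ltNge//; exact: glt.
split; first by move=> x y _ _; rewrite gle.
(* the pieces chosen by some point form a suborder of [K] *)
have [K1 [e [CK1 K1L [eA einj esurj] K1E]]] :
    exists (K1 : code) (e : nat -> nat), [/\ C K1, linear_order (cle K1),
      set_bij (carrier (cle K1)) (range ki) e &
      forall i j, carrier (cle K1) i -> carrier (cle K1) j ->
        cle K1 i j = cle K (e i) (e j)].
  apply: downward_suborder => //; last by exists (ki 0); exists 0.
  by move=> _ [x _ <-]; have [] := kiP x.
have eK i : carrier (cle K1) i -> carrier (cle K) (e i).
  by move=> /eA[x _ <-]; have [] := kiP x.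
have ltindex x y : rlt l x y -> cle K (ki x) (ki y).
  have [kx _ _ _] := kiP x; have [ky _ _ _] := kiP y.
  move=> xy; apply: (piece_lt_index KL RF KP kx ky (Pmid x) (Pmid y)).
  exact: inflate_lt_index.
exists K1, (fun i => [set x | ki x = e i]); split=> //.
- split; first split.
  + apply/seteqP; split=> x _; first by rewrite lF.2.
    have [i i1 ei] := esurj (ki x) (imageP ki (I : setT x)).
    by exists i.
  + move=> i j i1 j1 [x [/= xi xj]]; apply: einj; rewrite ?inE//.
    by rewrite -xi -xj.
  + by move=> i /eA[x _ <-]; exists x.
  move=> i j i1 j1; split=> [/andP[ij nij] x y /= xi yj|ltij].
    have nxy : x != y.
      by apply: contra_neq nij => Exy; apply: einj; rewrite ?inE// -xi -yj Exy.
    rewrite /rlt nxy andbT; apply: contraT; rewrite -full_ltNge// => /ltindex.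
    rewrite xi yj -K1E// => ji; case/eqP: nij.
    by case: K1L => _ _ _ a1 _; apply: a1; rewrite ij.
  have [x _ xi] := eA _ i1; have [y _ yj] := eA _ j1.
  have xy := ltij x y xi yj.
  rewrite /rlt K1E// -xi -yj ltindex//=; apply/eqP => Eij.
  by have := ltij x x xi; rewrite /= xi Eij => /(_ erefl); rewrite full_ltxx.
(* convexity of the image of a group: the markers over a point [y] between
   [g x] and [g x'] pull back to the markers over one point [z] *)
move=> i /eK Ki; split=> [x _|]; first by rewrite lF'.2.
move=> _ y _ [x /= xi <-] [x' /= x'i <-] /full_leVlt[<-|xy]; first by exists x.
move=> /full_leVlt[->|yx']; first by exists x'.
have pf := piso _ Ki.
have Px : P (e i) (x, mid x, 0) by rewrite -xi.
have Px' : P (e i) (x', mid x', 0) by rewrite -x'i.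
have [h hf hK] := piece_inv RF RF' pf (x, mid x, 0).
have zq q : (f @` P (e i)) (y, q, 0) /\ exists z, h (y, q, 0) = (z, q, 0).
  have b1 : rlt R' (f (x, mid x, 0)) (y, q, 0).
    by rewrite fmid; exact: inflate_lt_index.
  have b2 j : rlt R' (y, q, j) (f (x', mid x', 0)).
    by rewrite fmid; exact: inflate_lt_index.
  split.
    have [w Pw fw] := piece_between pf Px Px' (full_ltW b1) (full_ltW (b2 0)).
    by exists w.
  have [z [hz _]] :=
    marker_preserved lF' lF hf (imageP f Px) (imageP f Px') b1 b2.
  by exists z.
have [Iy0 [z hz]] := zq 0%R.
have hz' q : h (y, q, 0) = (z, q, 0).
  have [Iq [z' hq]] := zq q; rewrite hq; congr (_, _, _).
  case: (ltgtP q 0%R) => [lt|lt|E].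
  - by have := marker_index_const lF' lF hf Iq Iy0 lt hq hz.
  - by have := marker_index_const lF' lF hf Iy0 Iq lt hz hq.
  - by move: hq; rewrite E hz => -[].
have zP q : P (e i) (z, q, 0) /\ f (z, q, 0) = (y, q, 0).
  by have [[w Pw fw] _] := zq q; rewrite -hz' -fw hK.
exists z => /=.
  have [kz _ _ _] := kiP z; have [Pz _] := zP (mid z).
  by have := piece_uniq KP kz Ki (Pmid z) Pz.
by have [_] := zP (mid z); rewrite fmid => -[].
Qed.

End Deflate.

(** * The reduction *)

Lemma piecewise_inflate (C : set code) (l l' : rel nat) (c c' : nat -> nat)
    (g : nat -> nat) : full_order l -> full_order l' ->
  piecewise C l l' g -> (forall x, c' (g x) = c x) ->
  piecewise C (inflate l c) (inflate l' c') (fun p => (g p.1.1, p.1.2, p.2)).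
Proof.
move=> lF lF' [gemb [K [P [CK KP Pc]]]] gc.
have gle x y : l x y = l' (g x) (g y).
  have gE := gemb x y; rewrite lF.2 in gE.
  by apply/idP/idP => /(gE I I).
have ginj : injective g.
  by move=> x y E; apply: (full_anti lF); rewrite gle E full_refl.
split.
  move=> [[x q] i] [[y r] j] _ _.
  by rewrite /inflate /lexi_le /= !xpair_eqE (inj_eq ginj) gc -gle.
exists K, (fun k => [set p | P k p.1.1]); split=> //.
  case: KP => -[Pcov Ptriv Pne] Plt; split; first split.
  - rewrite (inflate_full c lF).2; apply/seteqP; split=> // p _.
    have : carrier l p.1.1 by rewrite lF.2.
    by rewrite -Pcov => -[k]; exists k.
  - by move=> i j ki kj [p [Pi Pj]]; apply: Ptriv ki kj _; exists p.1.1.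
  - by move=> i /Pne[x Px]; exists (x, 0%R, 0).
  move=> i j ki kj; rewrite (Plt i j ki kj).
  split=> [ltij [[x q] n] [[y r] m] Px Py|ltij x y Px Py].
    by apply: inflate_lt_index; exact: ltij.
  have := ltij (x, 0%R, 0) (y, 0%R, 0) Px Py.
  case/inflate_ltP => // [[_]|[_ _]]; first by rewrite ltxx.
  by rewrite full_ltxx.
move=> k kk; split=> [p _|]; first by rewrite (inflate_full c' lF').2.
move=> _ [[y r] m] _ [[[x q] n] Px <-] [[[x' q'] n'] Px' <-].
move=> /(inflate_le_index lF') /= xy /(inflate_le_index lF') /= yx'.
have [_ Pk] := Pc k kk.
have [z Pz zy] := Pk (g x) y (g x') (imageP g Px) (imageP g Px') xy yx'.
by exists (z, r, m) => //=; rewrite zy.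
Qed.

(** Transport of [piecewise] along a bijection [d]. *)
Lemma piecewise_pullback (C : set code) (T U : eqType) (d : T -> U) (e : U -> T)
    (r s : rel U) (f : U -> U) : cancel d e -> cancel e d ->
  piecewise C r s f ->
  piecewise C (fun a b => r (d a) (d b)) (fun a b => s (d a) (d b))
    (fun a => e (f (d a))).
Proof.
move=> dK eK [femb [K [P [CK [[Pcov Ptriv Pne] Plt] Pc]]]]; split.
  by move=> a b ra rb; rewrite !eK; exact: femb.
exists K, (fun k => d @^-1` P k); split=> //.
  split; first split.
  - apply/seteqP; split=> a.
      move=> [k kk Pa]; have : carrier r (d a) by rewrite -Pcov; exists k.
      by [].
    move=> ra; have : carrier r (d a) by [].
    by rewrite -Pcov => -[k]; exists k.
  - by move=> i j ki kj [a [Pi Pj]]; apply: Ptriv ki kj _; exists (d a).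
  - by move=> i /Pne[u Pu]; exists (e u); rewrite /= eK.
  move=> i j ki kj; rewrite (Plt i j ki kj).
  have dlt a b : rlt (fun a b => r (d a) (d b)) a b = rlt r (d a) (d b).
    by rewrite /rlt (can_eq dK).
  split=> [ltij a b Pa Pb|ltij u v Pu Pv]; first by rewrite dlt; exact: ltij.
  by have := ltij (e u) (e v); rewrite dlt /= !eK; apply.
move=> k kk; have [Psub Pk] := Pc k kk; split.
  by move=> _ [a Pa <-]; rewrite /carrier /= eK; apply: Psub; exists (d a).
move=> _ b _ [a1 Pa1 <-] [a2 Pa2 <-]; rewrite !eK => h1 h2.
have [u Pu fu] := Pk _ _ _ (imageP f Pa1) (imageP f Pa2) h1 h2.
by exists (e u); rewrite /= eK ?fu ?dK.
Qed.

Lemma nat_point_bij : exists (d : nat -> point) (e : point -> nat),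
  cancel d e /\ cancel e d.
Proof.
have inf : infinite_set [set: point].
  move=> fin; have : finite_set (snd @` [set: point]) by exact: finite_image.
  suff -> : snd @` [set: point] = [set: nat] by exact: infinite_nat.
  by apply/seteqP; split => // n _; exists (0, 0%R, n).
have /card_esym/card_set_bijP[d] := eq_card_nat (countableP [set: point]) inf.
by rewrite setTT_bijective => -[e de ed]; exists d, e.
Qed.

Lemma continuous_borel (X Y : topologicalType) (f : X -> Y) :
  continuous f -> borel_map f.
Proof.
move=> /continuousP fc; apply: smallest_sub.
  split.
  - by rewrite /= preimage_set0; apply: sigma_algebra0;
      exact: smallest_sigma_algebra.
  - move=> A /= sA; rewrite setTD -preimage_setC -setTD.
    by apply: sigma_algebraCD sA; exact: smallest_sigma_algebra.
  - move=> F sF /=; rewrite preimage_bigcup.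
    by apply: sigma_algebra_bigcup sF; exact: smallest_sigma_algebra.
by move=> B oB; apply: sub_sigma_algebra; exact: fc.
Qed.

Lemma LO_space_full (L : LO_space) : full_order (cle (set_val L)).
Proof. exact: (set_valP L). Qed.

Section Reduction.
Context (d : nat -> point).

(** The code of the inflated order of [L], read through an enumeration [d] of the
    points. *)
Definition inflate_code (L : cLO_space) : code :=
  fun p => inflate (cle (set_val L.1)) L.2 (d p.1) (d p.2).

Lemma inflate_codeP (e : point -> nat) (L : cLO_space) : cancel d e ->
  LO (inflate_code L).
Proof.
move=> dK; have F := inflate_full L.2 (LO_space_full L.1).
apply: (@full_orderI _ _ 0) => [x|y x z|x y|x y].
- exact: (full_refl F).
- exact: (full_trans F).
- by case/andP => xy yx; apply: (can_inj dK); exact: (full_anti F).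
- exact: (full_total F).
Qed.

Lemma inflate_code_continuous : continuous inflate_code.
Proof.
move=> L0; apply/pointwise_cvgP => -[m n]; apply/discrete_cvg.
pose x := (d m).1.1; pose y := (d n).1.1.
have cL : continuous (fun L : cLO_space => (set_val L.1 : code) (x, y)).
  move=> L; apply: (@continuous_comp cLO_space LO_space bool fst
    (fun M => (set_val M : code) (x, y))); first exact: cvg_fst.
  apply: (@continuous_comp LO_space code bool set_val (fun M => M (x, y))).
    exact: initial_continuous.
  exact: (@proj_continuous _ (fun _ => bool)).
have cc : continuous (fun L : cLO_space => L.2 x).
  move=> L; apply: (@continuous_comp cLO_space {ptws nat -> nat} nat snd
    (fun c => c x)); first exact: cvg_snd.
  exact: (@proj_continuous _ (fun _ => nat)).
have /discrete_cvg nL := cL L0; have /discrete_cvg nc := cc L0.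
change (\forall L \near L0, inflate_code L (m, n) = inflate_code L0 (m, n)).
near=> L.
have EL : (set_val L.1 : code) (x, y) = (set_val L0.1 : code) (x, y) by near: L.
have Ec : L.2 x = L0.2 x by near: L.
by rewrite /inflate_code /inflate /lexi_le /= /cle EL Ec.
Unshelve. all: by end_near. Qed.

End Reduction.

Theorem theorem6p9 (C : set code) (hScat : C `<=` Scat) (hne : C !=set0)
    (hdown : downward_closed C) (hccs : ccs C) :
  borel_bireducible (tri_cLO C) (tri_LO C).
Proof.
split.
  have [d [e [dK eK]]] := nat_point_bij.
  exists (fun L => SigSub (mem_set (inflate_codeP L dK)) : LO_space).
    apply: continuous_borel; apply: continuous_comp_initial.
    exact: inflate_code_continuous.
  move=> L L'.
  have lF : full_order (cle (set_val L.1)) := LO_space_full _.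
  have lF' : full_order (cle (set_val L'.1)) := LO_space_full _.
  split=> [[f fw fc]|[f fw]].
    have := piecewise_pullback dK eK (piecewise_inflate lF lF' fw fc).
    by exists (fun a => e (let p := d a in (f p.1.1, p.1.2, p.2))).
  have uncode (M : cLO_space) :
      (fun a b => inflate_code d M (e a, e b)) = inflate (cle (set_val M.1)) M.2.
    by apply/funext => a; apply/funext => b; rewrite /inflate_code /= !eK.
  have := piecewise_pullback eK dK fw.
  have -> : (fun a b => cle (inflate_code d L) (e a) (e b)) = _ := uncode L.
  have -> : (fun a b => cle (inflate_code d L') (e a) (e b)) = _ := uncode L'.
  by case/(piecewise_deflate hScat hdown lF lF') => g gw gc; exists g.
pose c0 : {ptws nat -> nat} := fun=> 0.
exists (fun L : LO_space => (L, c0) : cLO_space).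
  apply: continuous_borel => L.
  exact: (cvg_pair (cvg_id (F := nbhs L)) (cvg_cst c0)).
by move=> L L'; split=> [[f fw]|[f fw _]]; exists f.
Qed.
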